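(* Let $G$ be a digraph with an oriented near $\alpha$-valuation $p$, with associated partition $V(G)=V_{small}\cup V_{large}$, and let $l$ be a positive integer. Let $G_{l,1}$ be the digraph obtained from $G$ by replacing each vertex $s\in V_{small}$ by a set of $l$ vertices and each vertex $s\in V_{large}$ by a single vertex, and replacing each arc $(u,v)$ of $G$ by all arcs from the vertices replacing $u$ to the vertices replacing $v$. Then $G_{l,1}$ admits an oriented near $\alpha$-valuation.
   Context: Digraphs are oriented graphs. For a digraph $G$ with $n$ arcs, an oriented $\beta$-valuation is an injective $b:V(G)\to\{0,\ldots,n\}$ such that the multiset $\{b(v)-b(u)\bmod (n+1):(u,v)\text{ an arc}\}$ equals $\mathbb{Z}_{n+1}\setminus\{0\}$ (elements of $\mathbb{Z}_{n+1}$ identified with $0,\ldots,n$). An oriented near $\alpha$-valuation is an oriented $\beta$-valuation $b$ with a partition $V(G)=V_{small}\cup V_{large}$ such that each $v\in V_{small}$ has $b(v)<b(u)$ for all $u$ adjacent to $v$ in the underlying undirected graph, and each $v\in V_{large}$ has $b(v)>b(u)$ for all such $u$.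
   Formalization: The digraph G is assumed to have at least one arc; otherwise the claim fails for a single isolated vertex placed in V_small with l ≥ 2, since G_{l,1} then has l vertices and no arcs and admits no injective labelling into {0}. *)

(* Defs.v *)
From HB Require Import structures.
From mathcomp Require Import all_boot all_order all_algebra.

Set Implicit Arguments.
Unset Strict Implicit.
Unset Printing Implicit Defensive.

Import GRing.Theory.

(* Digraphs are finite oriented graphs: asymmetry of the arc relation excludes
   both loops and pairs of opposite arcs. *)
Record digraph := Digraph {
  vertex :> finType;
  arc : rel vertex;
  arc_asym : forall u v : vertex, arc u v -> ~~ arc v u
}.

Definition arcs (G : digraph) : {set G * G} := [set a | arc a.1 a.2].

Definition narcs (G : digraph) : nat := #|arcs G|.

Definition adjacent (G : digraph) : rel G := [rel u v | arc u v || arc v u].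

(* Labels live in 'I_(n.+1), n being the number of arcs: this type is both the
   ordered set {0, ..., n} and, through its canonical zmodType structure, the
   group Z_{n+1}, so that the subtraction below is taken modulo n + 1.
   Equality of multisets is perm_eq. *)
Definition oriented_beta_valuation (G : digraph)
    (b : G -> 'I_(narcs G).+1) : Prop :=
  injective b /\
  perm_eq [seq (b a.2 - b a.1)%R | a <- enum (arcs G)]
          (enum [set x : 'I_(narcs G).+1 | x != 0%R]).

Definition oriented_near_alpha_valuation (G : digraph)
    (b : G -> 'I_(narcs G).+1) (Vsmall Vlarge : {set G}) : Prop :=
  [/\ oriented_beta_valuation b,
      Vsmall :|: Vlarge = [set: G],
      [disjoint Vsmall & Vlarge],
      forall v u : G, v \in Vsmall -> adjacent v u -> (b v < b u)%N
    & forall v u : G, v \in Vlarge -> adjacent v u -> (b u < b v)%N].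

Definition admits_oriented_near_alpha_valuation (G : digraph) : Prop :=
  exists (b : G -> 'I_(narcs G).+1) (Vsmall Vlarge : {set G}),
    oriented_near_alpha_valuation b Vsmall Vlarge.

Section Blowup.

Variables (G : digraph) (m : G -> nat).

Definition blowup_vertex : finType := {v : G & 'I_(m v)}.

Definition blowup_arc : rel blowup_vertex :=
  [rel x y | arc (tag x) (tag y)].

Lemma blowup_arc_asym (x y : blowup_vertex) :
  blowup_arc x y -> ~~ blowup_arc y x.
Proof. exact: arc_asym. Qed.

(* Each vertex v is replaced by m v vertices, each arc by all arcs between the
   replacing sets. *)
Definition blowup : digraph := Digraph blowup_arc_asym.

End Blowup.

Definition blowup_l1 (G : digraph) (Vsmall : {set G}) (l : nat) : digraph :=
  blowup (fun v : G => if v \in Vsmall then l else 1).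

(* Main.v *)
From mathcomp Require Import all_boot all_order all_algebra.
From mathcomp Require Import zify.
Require Import Defs.

(** Every arc joins a small and a large vertex.  Give the [i]-th copy of a small
    vertex [s] the label [l * p s + i], and the copy of a large vertex [t] the
    label [l * p t].  The [l] arcs lying over an arc of value [d] modulo [n + 1]
    then take, modulo [l * n + 1], the values [l * (d - 1) + 1, ..., l * d],
    whichever way the arc points.  Only an isolated small vertex labelled [n] is
    problematic, since its copies number [i > 0] would get labels above [l * n];
    these are moved to [l * p t0 + i], where [t0] is any large vertex, as these
    labels are not used otherwise. *)

Set Implicit Arguments.
Unset Strict Implicit.
Unset Printing Implicit Defensive.

Import GRing.Theory.

(** * Differences modulo [n + 1] and oriented beta-valuations *)

Lemma val_ordB (n : nat) (i j : 'I_n.+1) :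
  val (i - j)%R = if j <= i then i - j else i + n.+1 - j.
Proof.
have lti := ltn_ord i; have ltj := ltn_ord j.
rewrite /= modnDmr; case: leqP => [leji | ltij].
  by rewrite addnBA 1?ltnW // addnC -addnBA // modnDl modn_small //; lia.
by rewrite modn_small; lia.
Qed.

Lemma arc_neq (G : digraph) (u v : G) : arc u v -> v != u.
Proof.
move=> auv; apply: contraNneq (arc_asym auv) => evu.
by rewrite evu -{2}evu.
Qed.

(** The differences are nonzero, since [b] is injective and there are no loops. There are as many
    nonzero residues as arcs, so pairwise distinct differences exhaust them. *)
Lemma oriented_beta_valuationP (G : digraph) (b : G -> 'I_(narcs G).+1) :
  oriented_beta_valuation b <->
  injective b /\ {in arcs G &, injective (fun a : G * G => b a.2 - b a.1)%R}.
Proof.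
split=> [[injb valb]|[injb injd]]; split=> //.
  by apply/dinjectiveP; rewrite /dinjectiveb (perm_uniq valb) enum_uniq.
have uniqd : uniq [seq (b a.2 - b a.1)%R | a <- enum (arcs G)].
  exact/dinjectiveP.
set nonzero := (X in perm_eq _ X).
have sub : {subset [seq (b a.2 - b a.1)%R | a <- enum (arcs G)] <= nonzero}.
  move=> z /mapP[[u v]]; rewrite mem_enum inE /= => auv ->.
  by rewrite mem_enum inE subr_eq0 (inj_eq injb) arc_neq.
have le_size :
    size nonzero <= size [seq (b a.2 - b a.1)%R | a <- enum (arcs G)].
  rewrite size_map -!cardE.
  have -> : [set x : 'I_(narcs G).+1 | x != 0%R] = [set~ 0%R].
    by apply/setP => x; rewrite !inE.
  by rewrite cardsC1 card_ord.
apply: uniq_perm; rewrite ?enum_uniq //.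
by case: (uniq_min_size uniqd sub le_size).
Qed.

(** * Counting the arcs of a blowup *)

Lemma narcsE (G : digraph) : narcs G = \sum_(u : G) \sum_(v : G) arc u v.
Proof.
rewrite /narcs /arcs cardsE -sum1_card big_mkcond pair_bigA /=.
by apply: eq_bigr => a _; rewrite unfold_in; case: arc.
Qed.

Lemma sum_blowup (G : digraph) (m : G -> nat) (F : G -> nat) :
  \sum_(x : blowup m) F (tag x) = \sum_(v : G) m v * F v.
Proof.
under [RHS]eq_bigr => v _ do rewrite -[m v]card_ord -sum_nat_const.
by rewrite (sig_big_dep (fun=> true) (fun _ _ => true) (fun v _ => F v)).
Qed.

Lemma narcs_blowup (G : digraph) (m : G -> nat) :
  narcs (blowup m) = \sum_(u : G) \sum_(v : G) m u * m v * arc u v.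
Proof.
rewrite narcsE.
rewrite (sum_blowup m (fun u => \sum_(y : blowup m) arc u (tag y))).
apply: eq_bigr => u _; rewrite (sum_blowup m (fun v => arc u v)) big_distrr.
by apply: eq_bigr => v _; rewrite /= mulnA.
Qed.

Lemma adjacentC (G : digraph) : symmetric (@adjacent G).
Proof. by move=> u v; apply: orbC. Qed.

(** Two adjacent vertices on the same side would each have a label strictly below the other's. *)
Lemma near_alpha_adjacent (G : digraph) (p : G -> 'I_(narcs G).+1)
    (Vsmall Vlarge : {set G}) (u v : G) :
  oriented_near_alpha_valuation p Vsmall Vlarge -> adjacent u v ->
  (v \in Vsmall) = (u \notin Vsmall).
Proof.
case=> _ cover _ small large auv.
have avu : adjacent v u by rewrite adjacentC.
have VlargeN w : w \notin Vsmall -> w \in Vlarge.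
  by move/negPf=> wS; have := in_setT w; rewrite -cover inE wS.
case: (boolP (u \in Vsmall)) (boolP (v \in Vsmall)) => uS [] // vS.
  by have := small _ _ uS auv; have := small _ _ vS avu; lia.
have := large _ _ (VlargeN _ uS) auv.
by have := large _ _ (VlargeN _ vS) avu; lia.
Qed.

(** * The labelling of the blowup *)

Section BlowupLabel.

Variables (G : digraph) (p : G -> 'I_(narcs G).+1) (Vsmall Vlarge : {set G}).
Variables (l : nat) (t0 : G).

Let H := blowup_l1 Vsmall l.

(** The test catches exactly the problematic copies: a positive copy number forces a small vertex,
    and a small vertex labelled [narcs G] has no neighbour. *)
Definition label_base (x : H) : G :=
  if (p (tag x) == narcs G :> nat) && (0 < tagged x) then t0 else tag x.

Definition blowup_label (x : H) : nat := l * p (label_base x) + tagged x.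

Context (p_val : oriented_near_alpha_valuation p Vsmall Vlarge) (l_gt0 : 0 < l).
Context (t0_large : t0 \notin Vsmall).

Lemma ltn_tagged (x : H) : tagged x < l.
Proof. by apply: leq_trans (ltn_ord _) _; case: ifP. Qed.

Lemma tagged_large (x : H) : tag x \notin Vsmall -> tagged x = 0 :> nat.
Proof.
move=> xL; apply/eqP; rewrite -leqn0 -ltnS.
by apply: leq_trans (ltn_ord _) _; rewrite (negPf xL).
Qed.

Lemma blowup_vertex_eq (x y : H) :
  tag x = tag y -> tagged x = tagged y :> nat -> x = y.
Proof.
by case: x y => [v i] [w j] /= evw; case: w / evw j => j /val_inj ->.
Qed.

(** Division by [l] recovers both the copy number, as remainder, and the label of the base, as
    quotient. *)
Lemma blowup_label_inj : injective blowup_label.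
Proof.
move=> x y exy; have [[injp _] _ _ _ _] := p_val.
have ltx := ltn_tagged x; have lty := ltn_tagged y.
have ei : tagged x = tagged y :> nat.
  have /(congr1 (modn^~ l)) := exy; rewrite /blowup_label !(mulnC l).
  by rewrite !modnMDl !modn_small.
apply: blowup_vertex_eq => //.
have /injp : p (label_base x) = p (label_base y).
  apply/val_inj/eqP; rewrite /= -(eqn_pmul2l l_gt0); apply/eqP.
  by move: exy; rewrite /blowup_label ei; exact: addIn.
have small (z : H) : 0 < tagged z -> tag z \in Vsmall.
  by apply: contraLR => /tagged_large ->.
rewrite /label_base -ei; have := small x; have := small y; rewrite -ei.
case: (posnP (tagged x)) => [|_ /(_ isT) yS /(_ isT) xS].
  by rewrite !andbF.
(* If both copies are moved, both tags carry the top label. If only one is, the other has tag [t0],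
   yet its positive copy number makes that tag small. *)
rewrite !andbT; case: eqP => ex; case: eqP => ey // e.
- by apply/injp/val_inj; rewrite /= ex ey.
- by move: t0_large; rewrite e yS.
- by move: t0_large; rewrite -e xS.
Qed.

Lemma blowup_label_le (x : H) : blowup_label x <= l * narcs G.
Proof.
have [[injp _] _ _ _ _] := p_val.
have ltx := ltn_tagged x.
case: (posnP (tagged x)) => [x0 | x_gt0].
  by rewrite /blowup_label x0 addn0 leq_mul2l -ltnS ltn_ord orbT.
have xS : tag x \in Vsmall.
  by apply: contraLR x_gt0 => /tagged_large ->.
(* A base labelled [narcs G] would have to be [t0], sharing this label with the small vertex
   [tag x]. *)
suff ltp : p (label_base x) < narcs G by rewrite /blowup_label; nia.
have le v : p v <= narcs G by rewrite -ltnS ltn_ord.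
rewrite ltn_neqAle le andbT /label_base x_gt0 andbT.
case: (eqVneq (val (p (tag x))) (narcs G)) => [ex | //] /=.
apply: contraNneq t0_large => et.
by rewrite (injp t0 (tag x)) //; apply/val_inj; rewrite /= ex et.
Qed.

Lemma blowup_label_adjacent (x : H) (u : G) :
  adjacent (tag x) u -> blowup_label x = l * p (tag x) + tagged x.
Proof.
move=> axu; rewrite /blowup_label /label_base.
case: ifP => // /andP[/eqP ep x_gt0]; have [_ _ _ small _] := p_val.
have xS : tag x \in Vsmall by apply: contraLR x_gt0 => /tagged_large ->.
by have := small _ _ xS axu; have := ltn_ord (p u); lia.
Qed.

(** Each arc has one small and one large end, hence [l * 1] arcs above it. *)
Lemma narcs_blowup_l1 : narcs H = l * narcs G.
Proof.
rewrite narcs_blowup [in RHS]narcsE big_distrr; apply: eq_bigr => u _.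
rewrite big_distrr; apply: eq_bigr => v _ /=.
case auv: (arc u v); last by rewrite !muln0.
have adj_uv : adjacent u v by rewrite /adjacent /= auv.
rewrite (near_alpha_adjacent p_val adj_uv).
by case: (u \in Vsmall); rewrite /= ?muln1 ?mul1n.
Qed.

(** [inord] would send an out-of-range label to 0; [blowup_label_le] and [narcs_blowup_l1] exclude
    this case. *)
Definition blowup_valuation (x : H) : 'I_(narcs H).+1 := inord (blowup_label x).

Lemma val_blowup_valuation x : blowup_valuation x = blowup_label x :> nat.
Proof. by rewrite inordK // ltnS narcs_blowup_l1 blowup_label_le. Qed.

Lemma blowup_valuation_inj : injective blowup_valuation.
Proof.
move=> x y /(congr1 val); rewrite /= !val_blowup_valuation.
exact: blowup_label_inj.
Qed.

Lemma blowup_label_lt (x y : H) : adjacent (tag x) (tag y) ->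
  tag x \in Vsmall -> blowup_label x < blowup_label y.
Proof.
move=> axy xS; have ayx : adjacent (tag y) (tag x) by rewrite adjacentC.
have yL : tag y \notin Vsmall by rewrite (near_alpha_adjacent p_val axy) xS.
have [_ _ _ small _] := p_val; have := small _ _ xS axy.
rewrite (blowup_label_adjacent axy) (blowup_label_adjacent ayx).
by have := ltn_tagged x; rewrite (tagged_large yL); nia.
Qed.

(** The predecessor moves the block [l * (d - 1) + 1, ..., l * d] to the numbers with quotient
    [d - 1] by [l]. *)
Lemma blowup_valuation_block (x y : H) : arc x y ->
  (val (blowup_valuation y - blowup_valuation x)%R).-1 %/ l =
  (val (p (tag y) - p (tag x))%R).-1.
Proof.
move=> arcxy; have axy : adjacent (tag x) (tag y) by apply/orP; left.
have ayx : adjacent (tag y) (tag x) by apply/orP; right.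
have [_ _ _ small _] := p_val.
have := near_alpha_adjacent p_val axy.
have := blowup_label_adjacent axy; have := blowup_label_adjacent ayx.
have := ltn_tagged x; have := ltn_tagged y.
have := ltn_ord (p (tag x)); have := ltn_ord (p (tag y)).
rewrite !val_ordB !val_blowup_valuation narcs_blowup_l1.
move: (nat_of_ord (tagged x)) (nat_of_ord (tagged y))
  (@tagged_large x) (@tagged_large y) => i j i0 j0.
move=> ltpy ltpx lt_j lt_i ey ex; case: (boolP (tag x \in Vsmall)) => xS /= yS.
  have ltL := blowup_label_lt axy xS; have ltp := small _ _ xS axy.
  rewrite (ltnW ltL) (ltnW ltp) ex ey j0 ?yS //.
  (* From small to large nothing wraps around, and the copy number counts down inside the block. *)
  have -> : (l * p (tag y) + 0 - (l * p (tag x) + i)).-1 =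
            (p (tag y) - p (tag x)).-1 * l + (l - i.+1) by nia.
  by rewrite divnMDl // divn_small ?addn0 //; lia.
have ltL := blowup_label_lt ayx yS; have ltp := small _ _ yS ayx.
rewrite leqNgt ltL leqNgt ltp /= ex ey i0 //.
(* From large to small both moduli are added once, and the copy number counts up inside the
   block. *)
have -> : (l * p (tag y) + j + (l * narcs G).+1 - (l * p (tag x) + 0)).-1 =
          (p (tag y) + (narcs G).+1 - p (tag x)).-1 * l + j by nia.
by rewrite divnMDl // divn_small ?addn0.
Qed.

(** Equal differences lie in the same block, hence over the same arc of [G]. Its large end has a
    single copy; cancelling the label of that copy identifies the small ends. *)
Lemma blowup_valuation_arc_inj :
  {in arcs H &, injective
     (fun a : H * H => blowup_valuation a.2 - blowup_valuation a.1)%R}.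
Proof.
have [/oriented_beta_valuationP[injp injd] _ _ _ _] := p_val.
case=> [x y] [x' y']; rewrite !inE /= => axy axy' e.
(* Positivity is needed to undo the predecessors in the block lemma. *)
have diff_gt0 (u v : G) : arc u v -> 0 < val (p v - p u)%R.
  move=> auv; rewrite lt0n -[0]/(val (0%R : 'I_(narcs G).+1)) (inj_eq val_inj).
  by rewrite subr_eq0 (inj_eq injp) arc_neq.
have [ex ey] : (tag x, tag y) = (tag x', tag y').
  apply: injd; rewrite ?inE //=; apply/val_inj.
  rewrite -[LHS]prednK ?diff_gt0 // -[RHS]prednK ?diff_gt0 //.
  by rewrite -!blowup_valuation_block // e.
have := near_alpha_adjacent (u := tag x) (v := tag y) p_val.
rewrite {1}/adjacent /= [arc _ _]axy => /(_ isT).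
case: (boolP (tag x \in Vsmall)) => xS /= yS.
  have eyy : y = y'.
    by apply: blowup_vertex_eq => //; rewrite !tagged_large -?ey ?yS.
  by move: e; rewrite eyy => /addrI/oppr_inj/blowup_valuation_inj ->.
have exx : x = x'.
  by apply: blowup_vertex_eq => //; rewrite !tagged_large -?ex.
by move: e; rewrite exx => /addIr/blowup_valuation_inj ->.
Qed.

Lemma blowup_valuation_near_alpha :
  oriented_near_alpha_valuation blowup_valuation
    [set x : H | tag x \in Vsmall] [set x : H | tag x \notin Vsmall].
Proof.
split=> [|||x y|x y].
- apply/oriented_beta_valuationP.
  by split; [exact: blowup_valuation_inj | exact: blowup_valuation_arc_inj].
- by apply/setP => x; rewrite !inE orbN.
- by rewrite disjoints_subset; apply/subsetP => x; rewrite !inE negbK.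
- by rewrite inE => xS axy; rewrite !val_blowup_valuation blowup_label_lt.
rewrite inE => xL axy; rewrite !val_blowup_valuation blowup_label_lt //.
  by rewrite adjacentC.
by rewrite (near_alpha_adjacent (u := tag x) p_val).
Qed.

End BlowupLabel.

Theorem theorem5p16 (G : digraph) (p : G -> 'I_(narcs G).+1)
    (Vsmall Vlarge : {set G}) (l : nat)
    (arc_gt0 : 0 < narcs G)
    (p_val : oriented_near_alpha_valuation p Vsmall Vlarge)
    (l_gt0 : 0 < l) :
  admits_oriented_near_alpha_valuation (blowup_l1 Vsmall l).
Proof.
(* Any arc has a large end. *)
have [t0 t0_large] : exists t0, t0 \notin Vsmall.
  have /card_gt0P[[u v]] := arc_gt0; rewrite inE /= => auv.
  have := near_alpha_adjacent (u := u) (v := v) p_val.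
  rewrite /adjacent /= auv => /(_ isT) vS.
  by case: (boolP (u \in Vsmall)) => uS; [exists v; rewrite vS uS | exists u].
exists (blowup_valuation p t0); do 2!eexists.
exact: blowup_valuation_near_alpha p_val l_gt0 t0_large.
Qed.
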